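(* Assume Martin's Axiom and the negation of the Continuum Hypothesis. Let $(M,d)$ be a separable metric space such that for every countable ordinal $\alpha<\omega_1$ the metric space $(\mathrm{S}_\alpha(\mathbb{Z}),d_\infty)$ coarsely embeds into $(M,d)$. Then every separable metric space coarsely embeds into $(M,d)$.
   Context: Schreier families $\mathrm{S}_\alpha\subset[\mathbb{N}]^{<\omega}$, $\alpha<\omega_1$ (where $[\mathbb{N}]^{<\omega}$ is the set of finite subsets of $\mathbb{N}$, and $n\le A<B$ means $n\le\min A\le\max A<\min B$): $\mathrm{S}_0=\{\{n\}:n\in\mathbb{N}\}$; $\mathrm{S}_{\alpha+1}=\{\bigcup_{j=1}^n E_j: n\in\mathbb{N}, E_j\in\mathrm{S}_\alpha, n\le E_1<\dots<E_n\}$; for limit $\beta$ with a fixed sequence $(\alpha_n)$ increasing to $\beta$, $\mathrm{S}_\beta=\{A:\exists n,\ n\le A,\ A\in\mathrm{S}_{\alpha_n}\}$. $\mathrm{S}_\alpha(\mathbb{Z})=\{\sum_{i\in G}c_ie_i: G\in\mathrm{S}_\alpha, c_i\in\mathbb{Z}\}\subset c_{00}$ with the sup-norm metric $d_\infty$. A map $f:X\to Y$ is a coarse embedding if there are non-decreasing $\rho,\omega:[0,\infty)\to[0,\infty)$ with $\lim_{t\to\infty}\rho(t)=\infty$ and $\rho(d_X(x,y))\le d_Y(f(x),f(y))\le\omega(d_X(x,y))$ for all $x,y$. *)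

(* Defs.v *)
From Stdlib Require Import Reals List Arith ZArith.
From Coquelicot Require Import Coquelicot.
Import ListNotations.
Open Scope R_scope.

Definition inj {A B : Type} (f : A -> B) : Prop := forall a b, f a = f b -> a = b.

Definition countable_set {T : Type} (A : T -> Prop) : Prop :=
  exists g : T -> nat, forall a b, A a -> A b -> g a = g b -> a = b.

Definition lt_continuum (I : Type) : Prop :=
  (exists f : I -> (nat -> bool), inj f) /\ ~ (exists g : (nat -> bool) -> I, inj g).

Definition compatible {P : Type} (le : P -> P -> Prop) (p q : P) : Prop :=
  exists r, le r p /\ le r q.

Definition ccc {P : Type} (le : P -> P -> Prop) : Prop :=
  forall A : P -> Prop,
    (forall p q, A p -> A q -> p <> q -> ~ compatible le p q) -> countable_set A.

Definition dense_in {P : Type} (le : P -> P -> Prop) (D : P -> Prop) : Prop :=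
  forall p, exists q, D q /\ le q p.

Definition is_filter {P : Type} (le : P -> P -> Prop) (G : P -> Prop) : Prop :=
  (exists p, G p) /\
  (forall p q, G p -> le p q -> G q) /\
  (forall p q, G p -> G q -> exists r, G r /\ le r p /\ le r q).

Definition MartinAxiom : Prop :=
  forall (P : Type) (le : P -> P -> Prop),
    inhabited P ->
    (forall p, le p p) ->
    (forall p q r, le p q -> le q r -> le p r) ->
    (forall p q, le p q -> le q p -> p = q) ->
    ccc le ->
    forall (I : Type) (D : I -> P -> Prop),
      lt_continuum I ->
      (forall i, dense_in le (D i)) ->
      exists G : P -> Prop, is_filter le G /\ (forall i, exists p, G p /\ D i p).

Definition CH : Prop :=
  forall A : (nat -> bool) -> Prop,
    countable_set A \/
    (exists h : (nat -> bool) -> (nat -> bool), inj h /\ forall x, A (h x)).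

Definition is_metric {X : Type} (d : X -> X -> R) : Prop :=
  (forall x y, 0 <= d x y) /\
  (forall x y, d x y = 0 <-> x = y) /\
  (forall x y, d x y = d y x) /\
  (forall x y z, d x z <= d x y + d y z).

Definition separable {X : Type} (d : X -> X -> R) : Prop :=
  exists D : X -> Prop, countable_set D /\
    forall x eps, 0 < eps -> exists a, D a /\ d x a < eps.

Definition coarse_embedding {X Y : Type} (dX : X -> X -> R) (dY : Y -> Y -> R)
  (f : X -> Y) : Prop :=
  exists rho omega : R -> R,
    (forall t, 0 <= t -> 0 <= rho t) /\ (forall t, 0 <= t -> 0 <= omega t) /\
    (forall s t, 0 <= s -> s <= t -> rho s <= rho t) /\
    (forall s t, 0 <= s -> s <= t -> omega s <= omega t) /\
    (forall K, exists T, forall t, T <= t -> K <= rho t) /\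
    (forall x y, rho (dX x y) <= dY (f x) (f y) /\ dY (f x) (f y) <= omega (dX x y)).

Definition coarsely_embeds {X Y : Type} (dX : X -> X -> R) (dY : Y -> Y -> R) : Prop :=
  exists f : X -> Y, coarse_embedding dX dY f.

Definition omega1_like {O : Type} (lt : O -> O -> Prop) : Prop :=
  (forall a, ~ lt a a) /\
  (forall a b c, lt a b -> lt b c -> lt a c) /\
  (forall a b, lt a b \/ a = b \/ lt b a) /\
  well_founded lt /\
  (forall b, countable_set (fun a => lt a b)) /\
  ~ countable_set (fun _ : O => True).

Definition is_zero {O : Type} (lt : O -> O -> Prop) (b : O) : Prop :=
  forall a, ~ lt a b.

Definition is_succ_of {O : Type} (lt : O -> O -> Prop) (a b : O) : Prop :=
  lt a b /\ forall c, lt a c -> ~ lt c b.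

Definition is_limit {O : Type} (lt : O -> O -> Prop) (b : O) : Prop :=
  (exists a, lt a b) /\ (forall a, lt a b -> exists c, lt a c /\ lt c b).

Definition fund_seqs {O : Type} (lt : O -> O -> Prop) (fs : O -> nat -> O) : Prop :=
  forall b, is_limit lt b ->
    (forall n, lt (fs b n) (fs b (S n))) /\
    (forall n, lt (fs b n) b) /\
    (forall a, lt a b -> exists n, lt a (fs b n)).

(* Finite subsets of N = {1,2,...} are represented by lists of naturals. *)
Definition nle_set (n : nat) (A : list nat) : Prop :=
  forall i, In i A -> (n <= i)%nat.

Definition lt_sets (A B : list nat) : Prop :=
  forall i j, In i A -> In j B -> (i < j)%nat.

Definition admissible (n : nat) (Es : list (list nat)) : Prop :=
  length Es = n /\
  (forall j, (j < n)%nat -> nth j Es [] <> []) /\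
  nle_set n (nth 0 Es []) /\
  (forall j k, (j < k)%nat -> (k < n)%nat -> lt_sets (nth j Es []) (nth k Es [])).

Definition schreier_system {O : Type} (lt : O -> O -> Prop) (fs : O -> nat -> O)
  (S : O -> list nat -> Prop) : Prop :=
  (forall b, is_zero lt b -> forall A, S b A <-> exists n, (1 <= n)%nat /\ A = [n]) /\
  (forall a b, is_succ_of lt a b -> forall A,
     S b A <-> exists (n : nat) (Es : list (list nat)),
       (1 <= n)%nat /\ admissible n Es /\ List.Forall (S a) Es /\ A = concat Es) /\
  (forall b, is_limit lt b -> forall A,
     S b A <-> exists n, (1 <= n)%nat /\ A <> [] /\ nle_set n A /\ S (fs b n) A).

Definition SZ {O : Type} (S : O -> list nat -> Prop) (a : O) (x : nat -> Z) : Prop :=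
  exists G, S a G /\ forall i, ~ In i G -> x i = 0%Z.

Definition dinf (x y : nat -> Z) : R :=
  real (Lub_Rbar (fun r => exists i, r = IZR (Z.abs (x i - y i)))).

Definition SZ_dist {O : Type} (S : O -> list nat -> Prop) (a : O)
  (u v : {x : nat -> Z | SZ S a x}) : R :=
  dinf (proj1_sig u) (proj1_sig v).

(* Main.v *)
(* The moduli of the given coarse embeddings f_a : S_a(Z) -> M are coded by aleph_1 non-
   decreasing functions nat -> nat. Under MA and not CH such a family is dominated modulo
   finite sets (Hechler forcing), so uncountably many of the f_a share a single modulus
   phi.

   Let z_0, z_1, ... be integer sequences with z_k supported in [0, k). Placing z_0, ...,
   z_(k-1) along a k-element A in S_a and applying f_a gives, up to an error 1, a finite
   sequence in a countable dense subset of M. The tree of S_a has rank at least a, so the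
   countably branching tree of all finite sequences obtained in this way has no countable
   rank. Hence it has an infinite branch, which embeds all the z_k with modulus about phi.

   By a coarse version of Aharoni's theorem such z_k encode a dense sequence of any
   separable metric space: the coordinate (k, i) is the integer part of a 1-Lipschitz bump
   of height k around the i-th point. *)

Require Import Defs.
From Stdlib Require Import Reals List Arith ZArith.
From Coquelicot Require Import Coquelicot.
From Stdlib Require Import Lia Lra Cantor Classical ClassicalEpsilon FunctionalExtensionality.
From Stdlib Require Import IndefiniteDescription.
Import ListNotations.

(** * Countable sets *)

Lemma countable_set_incl {T : Type} (A B : T -> Prop) :
  (forall x, A x -> B x) -> countable_set B -> countable_set A.
Proof. intros H [g Hg]. exists g. auto. Qed.

Lemma countable_set_image {T T' : Type} (A : T -> Prop) (B : T' -> Prop) (f : T -> T') :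
  (forall y, B y -> exists x, A x /\ f x = y) -> countable_set A -> countable_set B.
Proof.
  intros H [g Hg].
  destruct (classic (inhabited T)) as [HT | HT].
  - set (s := fun y => epsilon HT (fun x => A x /\ f x = y)).
    assert (Hs : forall y, B y -> A (s y) /\ f (s y) = y)
      by (intros y Hy; exact (epsilon_spec HT _ (H y Hy))).
    exists (fun y => g (s y)). intros x y Hx Hy E.
    destruct (Hs x Hx) as [Ax <-], (Hs y Hy) as [Ay <-].
    f_equal. auto.
  - exists (fun _ => 0%nat). intros x y Hx. destruct (H x Hx) as [x' _].
    exfalso; apply HT; constructor; exact x'.
Qed.

Lemma countable_set_fibers {T : Type} (A : T -> Prop) (k : T -> nat) :
  (forall n, countable_set (fun x => A x /\ k x = n)) -> countable_set A.
Proof.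
  intros H. destruct (functional_choice _ H) as [g Hg].
  exists (fun x => to_nat (k x, g (k x) x)). intros x y Ax Ay E.
  apply (f_equal of_nat) in E. rewrite !cancel_of_to in E. injection E as Ek Eg.
  apply (Hg (k x)); auto. rewrite Ek at 2. exact Eg.
Qed.

Lemma countable_set_range {T : Type} (u : nat -> T) :
  countable_set (fun x => exists n, u n = x).
Proof.
  apply (countable_set_image (fun _ : nat => True) _ u).
  - intros y [n Hn]. eauto.
  - exists (fun n => n). auto.
Qed.

Lemma countable_set_union {T : Type} (A B : T -> Prop) :
  countable_set A -> countable_set B -> countable_set (fun x => A x \/ B x).
Proof.
  intros HA HB.
  set (k := fun x => if excluded_middle_informative (A x) then 0%nat else 1%nat).
  apply (countable_set_fibers _ k). intros n.
  destruct n.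
  - apply (countable_set_incl _ A); trivial.
    intros x [_ Hk]. unfold k in Hk. destruct excluded_middle_informative; easy.
  - apply (countable_set_incl _ B); trivial.
    intros x [Hx Hk]. unfold k in Hk. destruct excluded_middle_informative; try easy.
    tauto.
Qed.

Fixpoint list_code (l : list nat) : nat :=
  match l with [] => 0 | x :: l => S (to_nat (x, list_code l)) end.

Lemma list_code_inj (l l' : list nat) : list_code l = list_code l' -> l = l'.
Proof.
  revert l'. induction l as [|x l IH]; intros [|x' l'] E; try easy.
  apply Nat.succ_inj, to_nat_inj in E. injection E as -> E. f_equal; auto.
Qed.

(** * Orders of type omega_1 and cardinality below the continuum *)

Lemma omega1_wf {O : Type} {lt : O -> O -> Prop} (HO : omega1_like lt) : well_founded lt.
Proof. apply HO. Qed.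

(** Regularity of omega_1: if [A] were countable and unbounded, the countable initial segments up to
    its elements would cover [O]. *)
Lemma omega1_countable_bounded {O : Type} {lt : O -> O -> Prop} (HO : omega1_like lt)
    (A : O -> Prop) :
  countable_set A -> exists b, forall a, A a -> lt a b.
Proof.
  destruct HO as (irr & tr & tot & wf & init & unc).
  intros [g Hg]. apply NNPP. intros Hn. apply unc.
  assert (H : forall b, exists a, A a /\ ~ lt a b).
  { intros b. apply NNPP. intros Hb. apply Hn. exists b.
    intros a Ha. apply NNPP. intros Hab. apply Hb. eauto. }
  destruct (functional_choice _ H) as [s Hs].
  apply (countable_set_fibers _ (fun b => g (s b))).
  intros n. destruct (classic (exists b, g (s b) = n)) as [[b Hb] | Hb].
  2: { exists (fun _ => 0%nat). intros x y [_ Hx]. exfalso; eauto. }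
  apply (countable_set_incl _ (fun x => lt x (s b) \/ exists n : nat, s b = x)).
  - intros x [_ Hx]. rewrite <- Hb in Hx.
    apply Hg in Hx; try apply Hs.
    destruct (Hs x) as [_ Hsx]. rewrite Hx in Hsx.
    destruct (tot x (s b)) as [E | [E | E]]; auto.
    + right. exists 0%nat. auto.
    + contradiction.
  - apply countable_set_union; auto. apply (countable_set_range (fun _ : nat => s b)).
Qed.

Lemma omega1_lt_succ {O : Type} {lt : O -> O -> Prop} (HO : omega1_like lt)
    (b : O) : exists c, lt b c.
Proof.
  destruct (omega1_countable_bounded HO _ (countable_set_range (fun _ : nat => b))) as [c Hc].
  exists c. apply Hc. exists 0%nat. auto.
Qed.

Lemma omega1_seq_bounded {O : Type} {lt : O -> O -> Prop} (HO : omega1_like lt)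
    (u : nat -> O) : exists b, forall n, lt (u n) b.
Proof.
  destruct (omega1_countable_bounded HO _ (countable_set_range u)) as [b Hb].
  exists b. intros n. apply Hb. eauto.
Qed.

Lemma omega1_inhabited {O : Type} {lt : O -> O -> Prop} (HO : omega1_like lt) : inhabited O.
Proof.
  apply NNPP. intros H. apply HO. exists (fun _ => 0%nat).
  intros a. exfalso; apply H; constructor; trivial.
Qed.

Lemma omega1_uncountable_cofinal {O : Type} {lt : O -> O -> Prop} (HO : omega1_like lt)
    (U : O -> Prop) :
  ~ countable_set U -> forall b, exists a, U a /\ ~ lt a b.
Proof.
  intros HU b. apply NNPP. intros H. apply HU.
  apply (countable_set_incl _ (fun a => lt a b)); [| apply HO].
  intros a Ha. apply NNPP. intros Hl. eauto.
Qed.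

Lemma omega1_infinite {O : Type} {lt : O -> O -> Prop} (HO : omega1_like lt) : exists e : nat -> O, inj e.
Proof.
  destruct (functional_choice _ (omega1_lt_succ HO)) as [s Hs].
  destruct (omega1_inhabited HO) as [o].
  set (e := nat_rect (fun _ => O) o (fun _ => s)).
  destruct HO as (irr & tr & _).
  assert (H : forall m n, (m < n)%nat -> lt (e m) (e n)).
  { induction 1 as [| n _ IH]; [apply Hs | exact (tr _ _ _ IH (Hs (e n)))]. }
  exists e. intros m n E.
  destruct (Nat.lt_trichotomy m n) as [L | [L | L]]; trivial;
    apply H in L; rewrite E in L; destruct (irr _ L).
Qed.

(** Transfinite recursion: each [f b] is chosen in [A] away from the earlier values, which form a
    countable set and so cannot exhaust [A]. *)
Lemma omega1_inj_uncountable {O : Type} {lt : O -> O -> Prop} (HO : omega1_like lt)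
    {T : Type} (A : T -> Prop) :
  ~ countable_set A -> exists f : O -> T, inj f /\ forall o, A (f o).
Proof.
  intros HA.
  assert (HT : inhabited T).
  { apply NNPP. intros H. apply HA. exists (fun _ => 0%nat).
    intros a. exfalso; apply H; constructor; exact a. }
  set (step := fun b (rec : forall a, lt a b -> T) =>
    epsilon HT (fun x => A x /\ forall a (h : lt a b), rec a h <> x)).
  set (f := Fix (omega1_wf HO) (fun _ => T) step).
  assert (Hf : forall b, A (f b) /\ forall a, lt a b -> f a <> f b).
  { intros b.
    assert (E : f b = step b (fun a _ => f a)).
    { apply (Fix_eq (omega1_wf HO) (fun _ => T)). intros x g g' Hg.
      replace g' with g; trivial.
      apply functional_extensionality_dep; intros y.
      apply functional_extensionality_dep; intros p. apply Hg. }
    rewrite E. unfold step.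
    apply epsilon_spec with (P := fun x => A x /\ forall a, lt a b -> f a <> x).
    apply NNPP. intros Hn. apply HA.
    apply (countable_set_image (fun a => lt a b) _ f); [| apply HO].
    intros y Hy. apply NNPP. intros H. apply Hn. exists y. split; trivial.
    intros a Ha E'. apply H. eauto. }
  assert (tot : forall a b, lt a b \/ a = b \/ lt b a) by apply HO.
  exists f. split; [| apply Hf].
  intros a b E. destruct (tot a b) as [L | [L | L]]; trivial.
  - destruct (proj2 (Hf b) a L E).
  - destruct (proj2 (Hf a) b L (eq_sym E)).
Qed.

(** A counterexample [A] to CH is uncountable, so [O] injects into it. An injection of the Cantor
    space into [O] would then place a copy of that space inside [A]. *)
Lemma omega1_lt_continuum {O : Type} {lt : O -> O -> Prop} (HO : omega1_like lt) : ~ CH -> lt_continuum O.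
Proof.
  intros HCH. apply not_all_ex_not in HCH. destruct HCH as [A HA].
  apply not_or_and in HA. destruct HA as [HA HA'].
  destruct (omega1_inj_uncountable HO A HA) as (f & Hf & HfA).
  split; [eauto |].
  intros [g Hg]. apply HA'. exists (fun x => f (g x)). split; auto.
  intros x y E. auto.
Qed.

(** * Hechler forcing and domination under Martin's Axiom *)

(** In a condition [(s, h)] the stem [s] is a finite initial part of the generic function, and [h]
    is a promised lower bound for all its later values. *)
Definition hechler_le (p q : list nat * (nat -> nat)) : Prop :=
  (length (fst q) <= length (fst p))%nat /\
  (forall i, (i < length (fst q))%nat -> nth i (fst p) 0%nat = nth i (fst q) 0%nat) /\
  (forall i, (snd q i <= snd p i)%nat) /\
  (forall i, (length (fst q) <= i < length (fst p))%nat -> (snd q i <= nth i (fst p) 0)%nat).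

Lemma hechler_le_refl p : hechler_le p p.
Proof. repeat split; auto. intros i Hi. lia. Qed.

Lemma hechler_le_trans p q r : hechler_le p q -> hechler_le q r -> hechler_le p r.
Proof.
  intros (A1 & A2 & A3 & A4) (B1 & B2 & B3 & B4). repeat split.
  - lia.
  - intros i Hi. rewrite A2 by lia. auto.
  - intros i. specialize (A3 i). specialize (B3 i). lia.
  - intros i Hi. destruct (Nat.lt_ge_cases i (length (fst q))).
    + rewrite A2 by trivial. apply B4. lia.
    + specialize (B3 i). specialize (A4 i). lia.
Qed.

Lemma hechler_le_antisym p q : hechler_le p q -> hechler_le q p -> p = q.
Proof.
  destruct p as [s h], q as [t k].
  intros (A1 & A2 & A3 & A4) (B1 & B2 & B3 & B4); simpl in *. f_equal.
  - apply nth_ext with 0%nat 0%nat; [lia |]. intros n Hn. apply A2. lia.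
  - apply functional_extensionality. intros i. apply Nat.le_antisymm; auto.
Qed.

(** Two conditions with the same stem are compatible through the sum of their bounds, and there are
    only countably many stems. *)
Lemma hechler_ccc : ccc hechler_le.
Proof.
  intros A HA. exists (fun p => list_code (fst p)).
  intros [s h] [t k] Hp Hq E. apply list_code_inj in E. simpl in E; subst t.
  apply NNPP. intros Hne. apply (HA _ _ Hp Hq Hne).
  exists (s, fun i => (h i + k i)%nat).
  split; repeat split; simpl; auto; intros i; lia.
Qed.

Lemma hechler_extend (s : list nat) (h f : nat -> nat) (n : nat) :
  exists t k, hechler_le (t, k) (s, h) /\ (n <= length t)%nat /\
    forall i, (f i <= k i)%nat.
Proof.
  exists (s ++ map h (seq (length s) n)), (fun i => (h i + f i)%nat).
  unfold hechler_le; simpl. rewrite length_app, length_map, length_seq.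
  repeat split; try lia.
  - intros i Hi. apply app_nth1; trivial.
  - intros i Hi. rewrite app_nth2 by lia.
    rewrite nth_indep with (d' := h 0%nat) by (rewrite length_map, length_seq; lia).
    rewrite map_nth, seq_nth by lia.
    replace (length s + (i - length s))%nat with i; lia.
Qed.

Lemma MA_dominating (MA : MartinAxiom) (I : Type) (e : nat -> I) (f : I -> nat -> nat) :
  lt_continuum I -> inj e ->
  exists g : nat -> nat, forall i, exists N, forall n, (N <= n)%nat -> (f i n <= g n)%nat.
Proof.
  intros HI He.
  (* The second clause makes [D (e n)] ask for a stem of length at least [n]. Thus the index set [I]
     alone also provides the dense sets that make the generic function total. *)
  set (D := fun i (p : list nat * (nat -> nat)) =>
    (forall n, (f i n <= snd p n)%nat) /\
    (forall n, e n = i -> (n <= length (fst p))%nat)).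
  assert (HD : forall i, dense_in hechler_le (D i)).
  { intros i [s h].
    assert (Hc : exists c, forall n, e n = i -> (n <= c)%nat).
    { destruct (classic (exists n, e n = i)) as [[c Hc] | Hc].
      - exists c. intros n Hn. rewrite <- Hc in Hn. apply He in Hn. lia.
      - exists 0%nat. intros n Hn. exfalso; eauto. }
    destruct Hc as [c Hc].
    destruct (hechler_extend s h (f i) c) as (t & k & L & Ht & Hk).
    exists (t, k). repeat split; simpl; trivial; try apply L.
    intros n Hn. apply Hc in Hn. lia. }
  destruct (MA _ hechler_le (inhabits ([], fun _ => 0%nat)) hechler_le_refl hechler_le_trans
    hechler_le_antisym hechler_ccc I D HI HD) as (G & (_ & HGup & HG) & HGD).
  assert (Hlong : forall n, exists p, G p /\ (n < length (fst p))%nat).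
  { intros n. destruct (HGD (e (S n))) as (p & Gp & _ & Hp). exists p.
    split; trivial. apply Hp. trivial. }
  destruct (functional_choice _ Hlong) as [q Hq].
  exists (fun n => nth n (fst (q n)) 0%nat).
  intros i. destruct (HGD i) as (p & Gp & Hp & _).
  exists (length (fst p)). intros n Hn.
  destruct (Hq n) as [Gq Lq].
  (* The stem of a common extension [r] agrees at [n] with that of [q n]. As [n] lies beyond the
     stem of [p], its value there also obeys the bound promised by [p]. *)
  destruct (HG p (q n) Gp Gq) as (r & Gr & (A1 & A2 & A3 & A4) & (B1 & B2 & B3 & B4)).
  rewrite <- B2 by trivial.
  eapply Nat.le_trans; [apply Hp |]. apply A4. lia.
Qed.

(* For non-decreasing functions, domination from [N] on by [g] gives domination everywhere
   by [g + g N], so only countably many bounds occur. *)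
Lemma MA_uniform_bound (MA : MartinAxiom) (HCH : ~ CH)
    {O : Type} {lt : O -> O -> Prop} (HO : omega1_like lt) (f : O -> nat -> nat) :
  (forall a m n, (m <= n)%nat -> (f a m <= f a n)%nat) ->
  exists g : nat -> nat, ~ countable_set (fun a => forall n, (f a n <= g n)%nat).
Proof.
  intros Hmon.
  destruct (omega1_infinite HO) as [e He].
  destruct (MA_dominating MA O e f (omega1_lt_continuum HO HCH) He) as [g Hg].
  destruct (functional_choice _ Hg) as [N HN].
  apply NNPP. intros Hn. apply HO.
  apply (countable_set_fibers _ N). intros k.
  apply (countable_set_incl _ (fun a => forall n, (f a n <= g n + g k)%nat)).
  - intros a [_ <-] n. destruct (Nat.le_ge_cases (N a) n) as [L | L].
    + specialize (HN a n L). lia.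
    + specialize (Hmon a _ _ L). specialize (HN a (N a) (le_n _)). lia.
  - apply NNPP. intros H. apply Hn. exists (fun n => (g n + g k)%nat). exact H.
Qed.

(** * Coarse embeddings of integer grids, with moduli coded by functions on the naturals *)

Definition close (n : nat) (x y : nat -> Z) : Prop :=
  forall i, (Z.abs (x i - y i) <= Z.of_nat n)%Z.

(** One function [phi] codes both moduli: it bounds the expansion and, read backwards, the
    compression. Enlarging [phi] preserves the property, so domination can be applied to it. *)
Definition grid_embedding {M : Type} (d : M -> M -> R) (A : (nat -> Z) -> Prop)
    (f : (nat -> Z) -> M) (phi : nat -> nat) : Prop :=
  forall x y n, A x -> A y ->
    (close n x y -> d (f x) (f y) <= INR (phi n)) /\
    (d (f x) (f y) < INR n -> close (phi n) x y).

Lemma grid_embedding_weaken {M : Type} (d : M -> M -> R) A f (phi psi : nat -> nat) :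
  (forall n, (phi n <= psi n)%nat) -> grid_embedding d A f phi -> grid_embedding d A f psi.
Proof.
  intros L H x y n Ax Ay. destruct (H x y n Ax Ay) as [H1 H2]. split.
  - intros C. apply Rle_trans with (INR (phi n)); auto. apply le_INR, L.
  - intros C i. specialize (H2 C i). specialize (L n). lia.
Qed.

Lemma INR_unbounded (r : R) : exists n, r <= INR n.
Proof.
  exists (Z.to_nat (up r)). destruct (archimed r) as [H _].
  destruct (Z.le_gt_cases 0 (up r)) as [L | L].
  - rewrite INR_IZR_INZ, Z2Nat.id by trivial. lra.
  - apply Rle_trans with 0; [| apply pos_INR]. apply (IZR_lt (up r) 0) in L. lra.
Qed.

Lemma bounded_of_finite_support (x : nat -> Z) (G : list nat) :
  (forall i, ~ In i G -> x i = 0%Z) -> exists B, forall i, (Z.abs (x i) <= B)%Z.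
Proof.
  intros H.
  assert (HB : exists B, (0 <= B)%Z /\ forall i, In i G -> (Z.abs (x i) <= B)%Z).
  { clear H. induction G as [|g G [B [HB IH]]].
    - exists 0%Z. split; [lia | easy].
    - exists (Z.max B (Z.abs (x g))). split; [lia |].
      intros i [<- | Hi]; [| specialize (IH i Hi)]; lia. }
  destruct HB as [B [HB0 HB]]. exists B. intros i.
  destruct (in_dec Nat.eq_dec i G) as [Hi | Hi]; [auto |]. rewrite H by trivial. simpl. lia.
Qed.

(** The bound [B] excludes an infinite least upper bound, which [real] would send to 0. *)
Lemma dinf_is_sup (x y : nat -> Z) (B : Z) :
  (forall i, (Z.abs (x i - y i) <= B)%Z) ->
  (forall i, IZR (Z.abs (x i - y i)) <= dinf x y) /\
  (forall r, (forall i, IZR (Z.abs (x i - y i)) <= r) -> dinf x y <= r).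
Proof.
  intros HB. unfold dinf. set (E := fun r => exists i, r = IZR (Z.abs (x i - y i))).
  destruct (Lub_Rbar_correct E) as [Hub Hleast].
  assert (H0 := Hub _ (ex_intro _ 0%nat eq_refl)).
  assert (H1 : Rbar_le (Lub_Rbar E) (Finite (IZR B))).
  { apply Hleast. intros r [i ->]. simpl. apply IZR_le, HB. }
  destruct (Lub_Rbar E) as [l | |]; try easy. simpl. split.
  - intros i. apply (Hub _ (ex_intro _ i eq_refl)).
  - intros r Hr. apply (Hleast (Finite r)). intros r' [i ->]. apply Hr.
Qed.

Lemma SZ_dinf {O : Type} (S : O -> list nat -> Prop) (a : O) (x y : nat -> Z) :
  SZ S a x -> SZ S a y ->
  0 <= dinf x y /\ forall n, dinf x y <= INR n <-> close n x y.
Proof.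
  intros (G & _ & HG) (H & _ & HH).
  destruct (bounded_of_finite_support _ _ HG) as [B HB].
  destruct (bounded_of_finite_support _ _ HH) as [C HC].
  destruct (dinf_is_sup x y (B + C)) as [Hub Hleast].
  { intros i. specialize (HB i). specialize (HC i). lia. }
  split.
  - apply Rle_trans with (2 := Hub 0%nat). apply IZR_le. lia.
  - intros n. rewrite INR_IZR_INZ. split.
    + intros L i. apply le_IZR. apply Rle_trans with (2 := L). apply Hub.
    + intros L. apply Hleast. intros i. apply IZR_le, L.
Qed.

(** Partial sums provide a non-decreasing majorant of an arbitrary [phi]. *)
Lemma le_sum_list_map (phi : nat -> nat) (n : nat) :
  (phi n <= list_sum (map phi (seq 0 (S n))))%nat.
Proof. rewrite seq_S, map_app, list_sum_app. simpl. lia. Qed.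

Lemma sum_list_map_mono (phi : nat -> nat) (m n : nat) : (m <= n)%nat ->
  (list_sum (map phi (seq 0 (S m))) <= list_sum (map phi (seq 0 (S n))))%nat.
Proof.
  induction 1; trivial. rewrite (seq_S (S m0)), map_app, list_sum_app. lia.
Qed.

Lemma grid_embedding_of_SZ {O : Type} (S : O -> list nat -> Prop) (a : O)
    {M : Type} (d : M -> M -> R) :
  (exists x, SZ S a x) -> coarsely_embeds (SZ_dist S a) d ->
  exists f phi, (forall m n, (m <= n)%nat -> (phi m <= phi n)%nat) /\
    grid_embedding d (SZ S a) f phi.
Proof.
  intros [x0 Hx0] (f & rho & omega & _ & _ & Hrho & Homega & Hinf & Hf).
  (* Outside [SZ S a] the map takes the irrelevant default value at [x0]. *)
  set (F := fun x => match excluded_middle_informative (SZ S a x) with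
    | left H => f (exist _ x H) | right _ => f (exist _ x0 Hx0) end).
  assert (HF : forall x y, SZ S a x -> SZ S a y ->
    rho (dinf x y) <= d (F x) (F y) <= omega (dinf x y)).
  { intros x y Ax Ay. unfold F.
    destruct excluded_middle_informative as [Hx |]; [| contradiction].
    destruct excluded_middle_informative as [Hy |]; [| contradiction].
    apply (Hf (exist _ x Hx) (exist _ y Hy)). }
  (* Here [k] exceeds both [omega (INR n)] and a threshold past which [rho] is at least [n]. *)
  assert (Hphi : forall n, exists k,
    omega (INR n) <= INR k /\ forall t, INR k < t -> INR n <= rho t).
  { intros n. destruct (Hinf (INR n)) as [T HT].
    destruct (INR_unbounded (omega (INR n))) as [k1 Hk1].
    destruct (INR_unbounded T) as [k2 Hk2].
    exists (k1 + k2)%nat. rewrite plus_INR.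
    pose proof (pos_INR k1). pose proof (pos_INR k2).
    split; [lra |]. intros t Ht. apply HT. lra. }
  destruct (functional_choice _ Hphi) as [phi Hp].
  exists F, (fun n => list_sum (map phi (seq 0 (Datatypes.S n)))).
  split; [apply sum_list_map_mono |].
  apply (grid_embedding_weaken d _ _ phi); [apply le_sum_list_map |].
  intros x y n Ax Ay. destruct (HF x y Ax Ay) as [H1 H2].
  destruct (Hp n) as [P1 P2]. destruct (SZ_dinf S a x y Ax Ay) as [D0 D]. split.
  - intros C. apply D in C. specialize (Homega _ _ D0 C). lra.
  - intros L. apply D. apply Rnot_lt_le. intros C. specialize (P2 _ C). lra.
Qed.

(** * Ranks of trees of finite sequences, and of the Schreier trees in particular *)

Section Rank.

Context {O : Type} {lt : O -> O -> Prop} (HO : omega1_like lt).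

(* [rank_ge F b A]: in the tree of lists satisfying [F], ordered by end extension, the
   node [A] has rank at least [b]. *)
Definition rank_ge (F : list nat -> Prop) : O -> list nat -> Prop :=
  Fix (omega1_wf HO) (fun _ => list nat -> Prop) (fun b rec A =>
    F A /\ forall c (h : lt c b), exists n, rec c h (A ++ [n])).

Lemma rank_geE F b A :
  rank_ge F b A <-> F A /\ forall c, lt c b -> exists n, rank_ge F c (A ++ [n]).
Proof.
  unfold rank_ge at 1. rewrite Fix_eq; [reflexivity |].
  intros x g g' Hg. replace g' with g; trivial.
  apply functional_extensionality_dep; intros y.
  apply functional_extensionality_dep; intros p. apply Hg.
Qed.

Lemma rank_ge_antitone F b c A : lt c b -> rank_ge F b A -> rank_ge F c A.
Proof.
  rewrite !rank_geE. intros L [HA H]. split; trivial.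
  intros c' L'. apply H. destruct HO as (_ & tr & _). eauto.
Qed.

(** Children of [A] become children of [l ++ A]. A one-element [l] serves the successor step of
    [schreier_rank], and the empty [l] compares two trees at limits. *)
Lemma rank_ge_shift (F F' : list nat -> Prop) l b :
  (forall A, F' A -> F (l ++ A)) -> forall A, rank_ge F' b A -> rank_ge F b (l ++ A).
Proof.
  intros HF. induction (omega1_wf HO b) as [b _ IH]. intros A.
  rewrite !rank_geE. intros [HA H]. split; auto.
  intros c L. destruct (H c L) as [n Hn]. exists n. rewrite <- app_assoc. auto.
Qed.

End Rank.

(** Subsets of members of [S a] suffice, since [SZ S a] only restricts where the support may lie.
    The order of the list is free, and the lower bound [N] leaves room for earlier entries in the
    induction on [a]. *)
Definition schreier_tree {O : Type} (S : O -> list nat -> Prop) (a : O) (N : nat)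
    (A : list nat) : Prop :=
  NoDup A /\ exists G, S a G /\ nle_set N G /\ incl A G.

Section Schreier.

Context {O : Type} {lt : O -> O -> Prop} {fs : O -> nat -> O} {S : O -> list nat -> Prop}.
Context (HO : omega1_like lt) (Hfs : fund_seqs lt fs) (HS : schreier_system lt fs S).

Lemma omega1_cases (b : O) :
  is_zero lt b \/ (exists a, is_succ_of lt a b) \/ is_limit lt b.
Proof.
  destruct (classic (is_zero lt b)) as [| Hz]; auto. right.
  destruct (classic (is_limit lt b)) as [| Hl]; auto. left.
  apply NNPP. intros Hn. apply Hl. split.
  - apply NNPP. intros H. apply Hz. intros a Ha. eauto.
  - intros a Ha. apply NNPP. intros H. apply Hn. exists a. split; trivial.
    intros c Hac Hcb. eauto.
Qed.

Lemma schreier_nonempty a A : S a A -> A <> [].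
Proof.
  destruct HS as (H0 & H1 & H2). destruct (omega1_cases a) as [Ha | [[b Hb] | Ha]]; intros H.
  - apply H0 in H; trivial. destruct H as (n & _ & ->). easy.
  - apply (H1 _ _ Hb) in H. destruct H as (n & Es & Hn & (Hlen & Hne & _) & _ & ->).
    specialize (Hne 0%nat ltac:(lia)). destruct Es as [| E Es]; simpl in *; [lia |].
    destruct E; easy.
  - apply H2 in H; trivial. destruct H as (n & _ & H & _). exact H.
Qed.

Lemma schreier_singleton a n : (1 <= n)%nat -> S a [n].
Proof.
  intros Hn. destruct HS as (H0 & H1 & H2).
  induction (omega1_wf HO a) as [a _ IH]. destruct (omega1_cases a) as [Ha | [[b Hb] | Ha]].
  - apply H0; eauto.
  - apply (H1 _ _ Hb). exists 1%nat, [[n]]. repeat split; auto.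
    + intros [| j] Hj; [easy | lia].
    + simpl. intros i [<- | []]. trivial.
    + intros j k Hj Hk. lia.
    + constructor; [apply IH, Hb | constructor].
  - apply H2; trivial. exists 1%nat. repeat split; auto; [easy | |].
    + intros i [<- | []]. trivial.
    + apply IH. apply (Hfs a Ha).
Qed.

(** The blocks [[n]] and [A] form an admissible pair because [2 <= n]. *)
Lemma schreier_succ_cons a b n A :
  is_succ_of lt a b -> (2 <= n)%nat -> S a A -> nle_set (Datatypes.S n) A -> S b (n :: A).
Proof.
  intros Hab Hn HA HnA. destruct HS as (_ & H1 & _). apply (H1 _ _ Hab).
  exists 2%nat, [[n]; A]. repeat split; auto.
  - intros [| [| j]] Hj; [easy | apply (schreier_nonempty a A HA) | lia].
  - simpl. intros i [<- | []]. trivial.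
  - intros [| j] [| [| k]] Hj Hk; try lia. simpl. intros i m [<- | []] Hm. apply HnA, Hm.
  - constructor; [apply schreier_singleton; lia | constructor; auto].
  - simpl. now rewrite app_nil_r.
Qed.

(** Induction on [a] for all [N] at once. At a successor, one entry is followed by the tree of the
    predecessor with a larger lower bound; at a limit, the tree of a large enough [fs a n] is
    contained in that of [a] once the lower bound reaches [n]. *)
Lemma schreier_rank a : forall N, rank_ge HO (schreier_tree S a N) a [].
Proof.
  induction (omega1_wf HO a) as [a _ IH]. intros N. apply rank_geE. split.
  { split; [constructor |]. exists [Datatypes.S N]. repeat split.
    - apply schreier_singleton. lia.
    - intros i [<- | []]. lia.
    - intros i []. }
  intros c Hc. destruct (omega1_cases a) as [Ha | [[b Hb] | Ha]].
  - destruct (Ha c Hc).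
  (* The entry [N + 2] is at least [N] and at least 2, as [schreier_succ_cons] demands; later
     entries start at [N + 3]. *)
  - exists (N + 2)%nat.
    assert (H : rank_ge HO (schreier_tree S a N) b ([N + 2]%nat ++ [])).
    { apply rank_ge_shift with (2 := IH b (proj1 Hb) (N + 3)%nat).
      intros A [HA (G & SG & NG & AG)]. split.
      - constructor; trivial. intros Hi. apply AG, NG in Hi. lia.
      - exists ((N + 2)%nat :: G). repeat split.
        + apply (schreier_succ_cons b); trivial; try lia.
          intros i Hi. apply NG in Hi. lia.
        + intros i [<- | Hi]; [| apply NG in Hi]; lia.
        + intros i [<- | Hi]; [left | right]; auto. }
    assert (tot : forall a b, lt a b \/ a = b \/ lt b a) by apply HO.
    destruct (tot c b) as [L | [-> | L]]; trivial.
    + apply rank_ge_antitone with b; trivial.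
    + destruct (proj2 Hb c L Hc).
  - destruct (Hfs a Ha) as (Hinc & Hlt & Hcof). destruct (Hcof c Hc) as [n Hn].
    assert (Hn' : lt c (fs a (Datatypes.S n))).
    { apply HO with (fs a n); trivial. }
    (* The limit clause asks for a positive index, hence the successor of [n]. Adding it to [N]
       keeps all entries above this index. *)
    assert (H := IH _ (Hlt (Datatypes.S n)) (N + Datatypes.S n)%nat). rewrite rank_geE in H.
    destruct (proj2 H c Hn') as [m Hm]. exists m.
    apply (rank_ge_shift HO) with (l := []) (2 := Hm).
    intros A [HA (G & SG & NG & AG)]. split; trivial. exists G. repeat split; trivial.
    + destruct HS as (_ & _ & H2). apply H2; trivial. exists (Datatypes.S n).
      repeat split; trivial; try lia.
      * apply (schreier_nonempty _ _ SG).
      * intros i Hi. apply NG in Hi. lia.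
    + intros i Hi. apply NG in Hi. lia.
Qed.

Lemma schreier_tree_rank_ge a b : ~ lt a b -> rank_ge HO (schreier_tree S a 0) b [].
Proof.
  intros Hab. assert (H := schreier_rank a 0).
  assert (tot : forall a b, lt a b \/ a = b \/ lt b a) by apply HO.
  destruct (tot a b) as [L | [<- | L]]; [contradiction | trivial |].
  exact (rank_ge_antitone HO _ _ _ _ L H).
Qed.

End Schreier.

(** * Placing sequences along branches, and the infinite branch *)

(** Along a node [A] of a Schreier tree this yields vectors of [SZ S a], isometrically for sequences
    supported below [length A]. *)
Fixpoint transport (A : list nat) (z : nat -> Z) (i : nat) : Z :=
  match A with
  | [] => 0%Z
  | a :: A => if (i =? a)%nat then z 0%nat else transport A (fun j => z (S j)) i
  end.

Lemma transport_notin A z i : ~ In i A -> transport A z i = 0%Z.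
Proof.
  revert z. induction A as [| a A IH]; intros z H; simpl; trivial.
  destruct (Nat.eqb_spec i a) as [-> |]; [| apply IH]; firstorder.
Qed.

Lemma transport_nth A z j :
  NoDup A -> (j < length A)%nat -> transport A z (nth j A 0%nat) = z j.
Proof.
  intros HA. revert z j. induction HA as [| a A Ha HA IH]; intros z j Hj; simpl in *; [lia |].
  destruct j as [| j]; [now rewrite Nat.eqb_refl |].
  destruct (Nat.eqb_spec (nth j A 0%nat) a) as [<- |].
  - destruct Ha. apply nth_In. lia.
  - apply (IH (fun j => z (S j))). lia.
Qed.

(** Vectors already placed do not move when the branch grows, so approximations chosen for them
    remain valid. *)
Lemma transport_snoc A n z :
  z (length A) = 0%Z -> transport (A ++ [n]) z = transport A z.
Proof.
  intros Hz. apply functional_extensionality. intros i.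
  revert z Hz. induction A as [| a A IH]; intros z Hz; simpl in *.
  - rewrite Hz. now destruct (i =? n)%nat.
  - now rewrite IH.
Qed.

Lemma close_transport A x y n :
  NoDup A -> (forall i, (length A <= i)%nat -> x i = 0%Z /\ y i = 0%Z) ->
  close n (transport A x) (transport A y) <-> close n x y.
Proof.
  intros HA Hxy. split; intros H i.
  - destruct (Nat.lt_ge_cases i (length A)) as [L | L].
    + rewrite <- (transport_nth A x i HA L), <- (transport_nth A y i HA L). apply H.
    + destruct (Hxy i L) as [-> ->]. simpl. lia.
  - destruct (in_dec Nat.eq_dec i A) as [Hi | Hi].
    + apply In_nth with (d := 0%nat) in Hi. destruct Hi as (j & Hj & <-).
      rewrite !transport_nth by trivial. apply H.
    + rewrite !transport_notin by trivial. simpl. lia.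
Qed.

Lemma dense_sequence {X : Type} (d : X -> X -> R) (x0 : X) :
  separable d -> exists a : nat -> X, a 0%nat = x0 /\
    forall x eps, 0 < eps -> exists i, d x (a i) < eps.
Proof.
  intros (D & [g Hg] & HD).
  set (a := fun n => match n with 0%nat => x0 | S n =>
    epsilon (inhabits x0) (fun x => D x /\ g x = n) end).
  exists a. split; trivial. intros x eps Heps.
  destruct (HD x eps Heps) as (y & Dy & Hy). exists (S (g y)).
  destruct (epsilon_spec (inhabits x0) (fun x => D x /\ g x = g y)) as [H1 H2]; [eauto |].
  simpl. now rewrite (Hg _ y H1 Dy H2).
Qed.

Lemma dependent_list_choice {T : Type} (t0 : T) (P : list T -> Prop) :
  P [] -> (forall l, P l -> exists t, P (l ++ [t])) ->
  exists u : nat -> T, forall k, P (map u (seq 0 k)).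
Proof.
  intros H0 HS.
  assert (H : forall l, exists t, P l -> P (l ++ [t])).
  { intros l. destruct (classic (P l)) as [Hl | Hl]; [| now exists t0].
    destruct (HS l Hl) as [t Ht]. now exists t. }
  destruct (functional_choice _ H) as [s Hs].
  set (L := nat_rect (fun _ => list T) [] (fun _ l => l ++ [s l])).
  exists (fun k => s (L k)). intros k.
  assert (E : map (fun k => s (L k)) (seq 0 k) = L k).
  { induction k as [| k IH]; trivial. now rewrite seq_S, map_app, IH. }
  rewrite E. clear E. induction k; simpl; auto.
Qed.

Lemma MA_grid_sequence_embeds (MA : MartinAxiom) (HCH : ~ CH)
    {M : Type} (d : M -> M -> R) (HM : is_metric d) (Hsep : separable d)
    {O : Type} {lt : O -> O -> Prop} {fs : O -> nat -> O} {S : O -> list nat -> Prop}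
    (HO : omega1_like lt) (Hfs : fund_seqs lt fs) (HS : schreier_system lt fs S)
    (Hemb : forall a : O, coarsely_embeds (SZ_dist S a) d)
    (z : nat -> nat -> Z) (Hz : forall k i, (k <= i)%nat -> z k i = 0%Z) :
  exists (m : nat -> M) (psi : nat -> nat), forall j k n,
    (close n (z j) (z k) -> d (m j) (m k) <= INR (psi n)) /\
    (d (m j) (m k) < INR n -> close (psi n) (z j) (z k)).
Proof.
  assert (HSZ : forall a, exists x, SZ S a x).
  { intros a. exists (fun _ => 0%Z), [1%nat].
    split; trivial. apply (schreier_singleton HO Hfs HS). lia. }
  assert (Hf : forall a, exists p : ((nat -> Z) -> M) * (nat -> nat),
    (forall m n, (m <= n)%nat -> (snd p m <= snd p n)%nat) /\
    grid_embedding d (SZ S a) (fst p) (snd p)).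
  { intros a. destruct (grid_embedding_of_SZ S a d (HSZ a) (Hemb a)) as (f & phi & H).
    now exists (f, phi). }
  destruct (functional_choice _ Hf) as [p Hp].
  destruct (MA_uniform_bound MA HCH HO (fun a => snd (p a)) (fun a => proj1 (Hp a)))
    as [phi HU].
  set (U := fun a => forall n, (snd (p a) n <= phi n)%nat) in HU.
  set (f := fun a => fst (p a)).
  assert (HfU : forall a, U a -> grid_embedding d (SZ S a) (f a) phi).
  { intros a Ua. apply grid_embedding_weaken with (1 := Ua). apply Hp. }
  clearbody f U. clear p Hp Hf Hemb.
  destruct (omega1_inhabited HO) as [o].
  destruct (dense_sequence d (f o (fun _ => 0%Z)) Hsep) as (b & _ & Hb).
  set (realized := fun t a A => length A = length t /\
    forall j, (j < length t)%nat -> d (f a (transport A (z j))) (b (nth j t 0%nat)) < 1).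
  (* A sequence [t] is kept if it is realized at nodes of arbitrarily large rank, where [a] may vary
     over [U] with the rank. *)
  set (good := fun t => forall g, exists a A,
    U a /\ realized t a A /\ rank_ge HO (schreier_tree S a 0) g A).
  assert (Hgood0 : good []).
  { intros g. destruct (omega1_uncountable_cofinal HO U HU g) as (a & Ua & Ha).
    exists a, []. split; trivial. split.
    - split; trivial. intros j Hj. simpl in Hj. lia.
    - apply (schreier_tree_rank_ge HO Hfs HS a g Ha). }
  assert (Hgood : forall t, good t -> exists m, good (t ++ [m])).
  { intros t Ht. apply NNPP. intros Hn.
    (* If no extension of [t] is good, each [m] has a rank [g m] at which it fails. These countably
       many ranks lie below some [g1]; a realization of [t] of rank [g2 > g1] has a child of rank at
       least [g1], and a dense point near the new image gives an [m] contradicting the choice of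
       [g m]. *)
    assert (Hg : forall m, exists g, forall a A, U a -> realized (t ++ [m]) a A ->
      ~ rank_ge HO (schreier_tree S a 0) g A).
    { intros m. apply NNPP. intros H. apply Hn. exists m. intros g.
      apply NNPP. intros H'. apply H. exists g. intros a A Ua Hr Hk. apply H'. eauto. }
    destruct (functional_choice _ Hg) as [g Hg'].
    destruct (omega1_seq_bounded HO g) as [g1 Hg1].
    destruct (omega1_lt_succ HO g1) as [g2 Hg2].
    destruct (Ht g2) as (a & A & Ua & [Hlen Hr] & Hk).
    rewrite rank_geE in Hk. destruct (proj2 Hk g1 Hg2) as [n Hn'].
    destruct (Hb (f a (transport (A ++ [n]) (z (length t)))) 1 Rlt_0_1) as [m Hm].
    apply (Hg' m a (A ++ [n]) Ua); [| exact (rank_ge_antitone HO _ _ _ _ (Hg1 m) Hn')].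
    split; rewrite !length_app; simpl; [lia |]. intros j Hj.
    destruct (Nat.lt_ge_cases j (length t)) as [L | L].
    - rewrite app_nth1 by trivial. rewrite transport_snoc; auto. apply Hz. lia.
    - replace j with (length t) by lia. rewrite app_nth2, Nat.sub_diag by lia. exact Hm. }
  destruct (dependent_list_choice 0%nat good Hgood0 Hgood) as [u Hu].
  (* Replacing two images by dense points changes their distance by less than 2. So [phi n + 2]
     bounds expansion and [phi (n + 2)] controls compression; the sum covers both. *)
  exists (fun k => b (u k)), (fun n => (phi n + 2 + phi (n + 2))%nat).
  (* The initial segment of length [K] reaches both [j] and [k]. The rank [o] is arbitrary, since
     only membership in the tree is extracted. *)
  intros j k n. set (K := Datatypes.S (j + k)).
  destruct (Hu K o) as (a & A & Ua & [Hlen Hr] & Hk).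
  rewrite length_map, length_seq in Hlen, Hr.
  assert (Hr' : forall i, (i < K)%nat -> d (f a (transport A (z i))) (b (u i)) < 1).
  { intros i Hi. specialize (Hr i Hi).
    rewrite (nth_indep _ 0%nat (u 0%nat)), map_nth, seq_nth in Hr; trivial.
    now rewrite length_map, length_seq. }
  apply rank_geE in Hk. destruct Hk as [(HA & G & SG & _ & AG) _].
  assert (HT : forall x, SZ S a (transport A x)).
  { intros x. exists G. split; trivial. intros i Hi. apply transport_notin. auto. }
  assert (Hj := Hr' j ltac:(lia)). assert (Hk' := Hr' k ltac:(lia)).
  assert (Hcl : forall n, close n (transport A (z j)) (transport A (z k)) <->
    close n (z j) (z k)).
  { intros n'. apply close_transport; trivial. intros i Hi. split; apply Hz; lia. }
  set (x := transport A (z j)) in *. set (y := transport A (z k)) in *.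
  destruct HM as (_ & _ & sym & tri).
  assert (T1 := tri (b (u j)) (f a x) (b (u k))).
  assert (T2 := tri (f a x) (f a y) (b (u k))).
  assert (T3 := tri (f a x) (b (u j)) (f a y)).
  assert (T4 := tri (b (u j)) (b (u k)) (f a y)).
  rewrite (sym (b (u j)) (f a x)) in T1. rewrite (sym (b (u k)) (f a y)) in T4.
  split.
  - intros C. apply Hcl in C.
    apply (HfU a Ua x y n (HT _) (HT _)) in C.
    rewrite !plus_INR. pose proof (pos_INR (phi (n + 2)%nat)). simpl. lra.
  - intros L. apply Hcl.
    assert (C : d (f a x) (f a y) < INR (n + 2)) by (rewrite plus_INR; simpl; lra).
    apply (HfU a Ua x y _ (HT _) (HT _)) in C.
    intros i. specialize (C i). lia.
Qed.

(** * Recovering real moduli from an integer modulus *)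

Lemma coarse_embedding_of_modulus {X Y : Type} (dX : X -> X -> R) (dY : Y -> Y -> R)
    (f : X -> Y) (phi : nat -> nat) :
  (forall x y, 0 <= dX x y) -> (forall x y, 0 <= dY x y) ->
  (forall n x y, (dX x y <= INR n -> dY (f x) (f y) <= INR (phi n)) /\
                 (dY (f x) (f y) < INR n -> dX x y <= INR (phi n))) ->
  coarse_embedding dX dY f.
Proof.
  intros HX HY H.
  (* The lower modulus at [t] will be the supremum of [E t]. Using [n + phi n] rather than [phi n]
     bounds [E t] by [t] even if [phi] is bounded. *)
  set (E := fun t r => r = 0 \/ exists n, r = INR n /\ INR (n + phi n) < t).
  assert (Hrho : forall t, exists r, 0 <= t -> is_lub (E t) r).
  { intros t. destruct (Rle_dec 0 t) as [Ht | Ht]; [| exists 0; contradiction].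
    destruct (completeness (E t)) as [r Hr].
    - exists t. intros r [-> | (n & -> & Hn)]; trivial.
      rewrite plus_INR in Hn. pose proof (pos_INR (phi n)). lra.
    - exists 0. now left.
    - now exists r. }
  destruct (functional_choice _ Hrho) as [rho Hr].
  set (psi := fun n => list_sum (map phi (seq 0 (S n)))).
  assert (Hpsi : forall t, 0 <= t -> t <= INR (Z.to_nat (up t))).
  { intros t Ht. destruct (archimed t) as [L _].
    rewrite INR_IZR_INZ, Z2Nat.id; [lra |]. apply le_IZR. lra. }
  exists rho, (fun t => INR (psi (Z.to_nat (up t)))). repeat split.
  - intros t Ht. apply (Hr t Ht). now left.
  - intros t _. apply pos_INR.
  - intros s t Hs Hst. apply (Hr s Hs). intros r Er.
    apply (Hr t); [lra |]. destruct Er as [-> | (n & -> & Hn)]; [now left | right].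
    exists n. split; trivial. lra.
  - intros s t Hs Hst. apply le_INR, sum_list_map_mono.
    apply Z2Nat.inj_le; [apply le_IZR | apply le_IZR | apply Z.lt_succ_r, lt_IZR];
      destruct (archimed s), (archimed t); try lra.
    rewrite succ_IZR. lra.
  - intros K. destruct (INR_unbounded K) as [n Hn]. exists (INR (n + phi n) + 1).
    intros t Ht. pose proof (pos_INR (n + phi n)).
    apply Rle_trans with (1 := Hn). apply (Hr t); [lra |]. right. exists n.
    split; trivial. lra.
  - apply (Hr _ (HX x y)). intros r [-> | (n & -> & Hn)]; [apply HY |].
    apply Rnot_lt_le. intros L. apply H in L.
    rewrite plus_INR in Hn. pose proof (pos_INR n). lra.
  - apply Rle_trans with (INR (phi (Z.to_nat (up (dX x y))))).
    + apply H, Hpsi, HX.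
    + apply le_INR, le_sum_list_map.
Qed.

(** * Bump functions and the coarse Aharoni embedding *)

Fixpoint min_dist {X : Type} (d : X -> X -> R) (a : nat -> X) (i : nat) (c : R) (x : X) : R :=
  match i with
  | 0%nat => c
  | S i => Rmin (min_dist d a i c x) (d x (a i))
  end.

Lemma min_dist_le {X : Type} (d : X -> X -> R) a i c x j :
  (j < i)%nat -> min_dist d a i c x <= d x (a j).
Proof.
  induction i as [| i IH]; intros Hj; simpl; [lia |].
  destruct (Nat.eq_dec j i) as [-> |]; [apply Rmin_r |].
  apply Rle_trans with (1 := Rmin_l _ _). apply IH. lia.
Qed.

Lemma min_dist_le_const {X : Type} (d : X -> X -> R) a i c x : min_dist d a i c x <= c.
Proof.
  induction i as [| i IH]; simpl; [lra |]. apply Rle_trans with (1 := Rmin_l _ _). trivial.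
Qed.

Lemma min_dist_ge {X : Type} (d : X -> X -> R) a i c x r :
  r <= c -> (forall j, (j < i)%nat -> r <= d x (a j)) -> r <= min_dist d a i c x.
Proof.
  intros Hc H. induction i as [| i IH]; simpl; trivial.
  apply Rmin_glb; [apply IH; intros; apply H; lia | apply H; lia].
Qed.

(* The bump at scale [k] around [a i]: it equals [k] at any [x] such that [a i] is the
   first term within [k] of [x] and [2 * k <= d x (a 0)]; it vanishes at distance [2 * k]
   from [a i], at all terms before [a i], and within [k] of [a 0]. *)
Definition bump {X : Type} (d : X -> X -> R) (a : nat -> X) (k i : nat) (x : X) : R :=
  Rmin (Rmin (min_dist d a i (INR k) x) (Rmax 0 (2 * INR k - d x (a i))))
       (Rmax 0 (d x (a 0%nat) - INR k)).

Section Bump.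

Context {X : Type} (d : X -> X -> R) (Hd : is_metric d) (a : nat -> X).

(** The ingredients are distances and constants, and minima and maxima preserve the Lipschitz
    constant 1. *)
Lemma bump_lipschitz k i x y : bump d a k i x <= bump d a k i y + d x y.
Proof.
  destruct Hd as (pos & _ & sym & tri).
  assert (L : forall j, d x (a j) <= d y (a j) + d x y).
  { intros j. specialize (tri x y (a j)). lra. }
  assert (L' : forall j, d y (a j) <= d x (a j) + d x y).
  { intros j. specialize (tri y x (a j)). rewrite (sym y x) in tri. lra. }
  assert (P := pos x y).
  assert (H : min_dist d a i (INR k) x <= min_dist d a i (INR k) y + d x y).
  { clear -L P. induction i as [| i IH]; simpl; [lra |]. specialize (L i).
    unfold Rmin; repeat destruct Rle_dec; lra. }
  unfold bump. specialize (L 0%nat). specialize (L' i).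
  unfold Rmin, Rmax; repeat destruct Rle_dec; lra.
Qed.

Lemma bump_nonneg k i x : 0 <= bump d a k i x.
Proof.
  destruct Hd as (pos & _). apply Rmin_glb; [apply Rmin_glb |]; try apply Rmax_l.
  apply min_dist_ge; [apply pos_INR | auto].
Qed.

Lemma bump_eq0 k i x j :
  (j < i)%nat /\ x = a j \/ 2 * INR k <= d x (a i) \/ d x (a 0%nat) <= INR k ->
  bump d a k i x = 0.
Proof.
  intros H. apply Rle_antisym; [| apply bump_nonneg].
  destruct H as [[L ->] | [L | L]].
  - apply Rle_trans with (1 := Rmin_l _ _), Rle_trans with (1 := Rmin_l _ _).
    apply Rle_trans with (1 := min_dist_le d a i _ _ j L).
    destruct Hd as (_ & refl & _). apply Req_le. now apply refl.
  - apply Rle_trans with (1 := Rmin_l _ _), Rle_trans with (1 := Rmin_r _ _).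
    apply Rmax_lub; lra.
  - apply Rle_trans with (1 := Rmin_r _ _). apply Rmax_lub; lra.
Qed.

(** Starting from [p], where the distance is 0, one descends to earlier terms closer than [k] until
    none is left. At the final index all three terms of the minimum are at least [k]. *)
Lemma bump_attained k x p :
  x = a p -> 2 * INR k <= d x (a 0%nat) ->
  exists i, d x (a i) <= INR k /\ bump d a k i x = INR k.
Proof.
  intros Hp H0. destruct Hd as (_ & refl & _).
  assert (Hi : exists i, d x (a i) <= INR k /\ forall j, (j < i)%nat -> INR k <= d x (a j)).
  { assert (Hp' : d x (a p) <= INR k).
    { subst x. rewrite (proj2 (refl _ _) eq_refl). apply pos_INR. }
    clear Hp. induction (lt_wf p) as [p _ IH].
    destruct (classic (exists j, (j < p)%nat /\ d x (a j) < INR k)) as [(j & Lj & Hj) | H].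
    - apply (IH j Lj). lra.
    - exists p. split; trivial. intros j Lj. apply Rnot_lt_le. eauto. }
  destruct Hi as (i & Hi & Hj). exists i. split; trivial. apply Rle_antisym.
  - apply Rle_trans with (1 := Rmin_l _ _), Rle_trans with (1 := Rmin_l _ _).
    apply min_dist_le_const.
  - apply Rmin_glb; [apply Rmin_glb |].
    + apply min_dist_ge; [lra | trivial].
    + apply Rle_trans with (2 := Rmax_r _ _). lra.
    + apply Rle_trans with (2 := Rmax_r _ _). lra.
Qed.

End Bump.

Lemma Int_part_INR n : Int_part (INR n) = Z.of_nat n.
Proof. symmetry. apply Int_part_spec. rewrite <- INR_IZR_INZ. lra. Qed.

(** Integer parts of 1-Lipschitz bumps give the upper estimate. Conversely, of two points more than
    [4 * S n] apart, one is at least [2 * S n] from [a 0]; some bump of height [S n] is full there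
    and vanishes at the other point. *)
Lemma sequence_grid_embedding {X : Type} (d : X -> X -> R) (Hd : is_metric d) (a : nat -> X) :
  exists F : nat -> nat -> Z,
    (forall i, F 0%nat i = 0%Z) /\
    (forall p, exists s, forall i, (s <= i)%nat -> F p i = 0%Z) /\
    (forall p q n, d (a p) (a q) <= INR n -> close (S n) (F p) (F q)) /\
    (forall p q n, close n (F p) (F q) -> d (a p) (a q) <= INR (4 * S n)).
Proof.
  set (F := fun p m => let (k, i) := of_nat m in Int_part (bump d a k i (a p))).
  assert (F0 : forall p k i, bump d a k i (a p) = 0 -> Int_part (bump d a k i (a p)) = 0%Z).
  { intros p k i ->. exact (Int_part_INR 0). }
  assert (refl : forall x, d x x = 0) by (intros x; now apply Hd).
  exists F. repeat split.
  - intros m. unfold F. destruct (of_nat m) as [k i]. apply F0, (bump_eq0 d Hd a k i _ 0).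
    right; right. rewrite refl. apply pos_INR.
  - intros p. destruct (INR_unbounded (d (a p) (a 0%nat))) as [K HK].
    (* Only coordinates [(k, i)] with [k < K] and [i <= p] can be nonzero, and their codes lie below
       this number. *)
    exists ((K + p + 1) * (K + p + 2))%nat. intros m Hm. unfold F.
    destruct (of_nat m) as [k i] eqn:E. apply F0, (bump_eq0 d Hd a k i _ p).
    destruct (Nat.lt_ge_cases p i) as [L | L]; [now left |].
    destruct (Nat.le_gt_cases K k) as [L' | L'].
    + right; right. apply le_INR in L'. lra.
    + exfalso. apply (f_equal to_nat) in E. rewrite cancel_to_of in E.
      pose proof (to_nat_spec k i). nia.
  - assert (H : forall p q n m, d (a p) (a q) <= INR n -> (F p m - F q m <= Z.of_nat (S n))%Z).
    { intros p q n m H. unfold F. destruct (of_nat m) as [k i].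
      apply Zlt_succ_le, lt_IZR. rewrite succ_IZR, minus_IZR, <- INR_IZR_INZ, S_INR.
      pose proof (bump_lipschitz d Hd a k i (a p) (a q)).
      destruct (base_Int_part (bump d a k i (a p))), (base_Int_part (bump d a k i (a q))).
      lra. }
    intros p q n L m. assert (L' : d (a q) (a p) <= INR n).
    { destruct Hd as (_ & _ & sym & _). now rewrite sym. }
    apply H with (m := m) in L, L'. lia.
  - assert (H : forall p q n, close n (F p) (F q) -> 2 * INR (S n) <= d (a p) (a 0%nat) ->
      d (a p) (a q) <= INR (4 * S n)).
    { intros p q n C L. apply Rnot_lt_le. intros L'.
      destruct (bump_attained d Hd a (S n) (a p) p eq_refl L) as (i & Hi & E).
      assert (E' : bump d a (S n) i (a q) = 0).
      (* The point [a i] is within [S n] of [a p], so [a q] is more than [3 * S n] away from it. *)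
      { apply (bump_eq0 d Hd a _ _ _ 0). right; left.
        destruct Hd as (_ & _ & sym & tri). specialize (tri (a p) (a i) (a q)).
        rewrite (sym (a i)) in tri. rewrite mult_INR in L'. simpl (INR 4) in L'.
        pose proof (pos_INR (S n)). lra. }
      specialize (C (to_nat (S n, i))). unfold F in C. rewrite cancel_of_to in C.
      rewrite E, (F0 _ _ _ E'), Int_part_INR in C. lia. }
    intros p q n C. apply Rnot_lt_le. intros L'.
    destruct Hd as (_ & _ & sym & tri).
    destruct (Rle_lt_dec (2 * INR (S n)) (d (a p) (a 0%nat))) as [L | L].
    { apply (H p q n C) in L. lra. }
    destruct (Rle_lt_dec (2 * INR (S n)) (d (a q) (a 0%nat))) as [L1 | L1].
    { rewrite sym in L'. apply (Rlt_not_le _ _ L'), H; trivial.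
      intros i. specialize (C i). lia. }
    specialize (tri (a p) (a 0%nat) (a q)). rewrite (sym (a 0%nat)) in tri.
    rewrite mult_INR in L'. simpl (INR 4) in L'. lra.
Qed.

(** * From a dense sequence of an arbitrary separable space to the coarse embedding *)

Theorem theoremB :
  MartinAxiom -> ~ CH ->
  forall (M : Type) (d : M -> M -> R), is_metric d -> separable d ->
  forall (O : Type) (lt : O -> O -> Prop) (fs : O -> nat -> O)
         (S : O -> list nat -> Prop),
    omega1_like lt -> fund_seqs lt fs -> schreier_system lt fs S ->
    (forall a : O, coarsely_embeds (SZ_dist S a) d) ->
    forall (X : Type) (dX : X -> X -> R), is_metric dX -> separable dX ->
      coarsely_embeds dX d.
Proof.
  intros MA HCH M d HM Hsep O lt fs S HO Hfs HS Hemb X dX HX HXsep.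
  destruct (classic (inhabited X)) as [[x0] | HXe].
  2: { assert (HXn : X -> False) by (intros x; apply HXe; now constructor).
    exists (fun x => False_rect M (HXn x)), (fun t => t), (fun t => t).
    repeat split; try easy. intros K. now exists K. }
  destruct (dense_sequence dX x0 HXsep) as (a & _ & Ha).
  destruct (sequence_grid_embedding dX HX a) as (F & F0 & Fs & F1 & F2).
  destruct (functional_choice _ Fs) as [s Hs].
  (* The enumeration [e] names [p] only at times [k >= s p], so [F (e k)] is supported below [k].
     Until then it names 0, whose vector is zero. *)
  set (e := fun k => let (p, _) := of_nat k in if (s p <=? k)%nat then p else 0%nat).
  assert (He : forall p, exists k, e k = p).
  { intros p. exists (to_nat (p, s p)). unfold e. rewrite cancel_of_to.
    destruct (Nat.leb_spec (s p) (to_nat (p, s p))) as [| L]; trivial.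
    pose proof (to_nat_non_decreasing p (s p)). lia. }
  destruct (MA_grid_sequence_embeds MA HCH d HM Hsep HO Hfs HS Hemb (fun k => F (e k)))
    as (m & psi & Hm).
  { intros k i Hi. unfold e. destruct (of_nat k) as [p ?].
    destruct (Nat.leb_spec (s p) k); [apply Hs; lia | apply F0]. }
  assert (Hk : forall x, exists k, dX x (a (e k)) < 1).
  { intros x. destruct (Ha x 1 Rlt_0_1) as [p Hp]. destruct (He p) as [k <-]. eauto. }
  destruct (functional_choice _ Hk) as [kk Hkk].
  exists (fun x => m (kk x)).
  apply coarse_embedding_of_modulus with
    (* Moving both points to the dense sequence costs 2 in distance. Rounding in [F] costs 1 more,
       hence [n + 3]; the other summand is the lower estimate for [F] at [psi n], plus 2. *)
    (phi := fun n => (psi (n + 3) + (4 * Datatypes.S (psi n) + 2))%nat);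
    [apply HX | apply HM |].
  destruct HX as (_ & _ & sym & tri). intros n x y.
  assert (Lx := Hkk x). assert (Ly := Hkk y).
  set (x' := a (e (kk x))) in *. set (y' := a (e (kk y))) in *.
  assert (T1 := tri x' x y'). assert (T2 := tri x y y').
  assert (T3 := tri x x' y). assert (T4 := tri x' y' y).
  rewrite (sym x' x) in T1. rewrite (sym y' y) in T4. split.
  - intros L.
    assert (L' : dX x' y' <= INR (n + 2)) by (rewrite plus_INR; simpl; lra).
    apply F1 in L'. replace (Datatypes.S (n + 2)) with (n + 3)%nat in L' by lia.
    apply Hm in L'. apply Rle_trans with (1 := L'), le_INR. lia.
  - intros L. apply Hm, F2 in L. fold x' y' in L. rewrite !plus_INR. simpl (INR 2).
    pose proof (pos_INR (psi (n + 3)%nat)). lra.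
Qed.
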